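(* Let $r>0$ and $\alpha=e^{-r}$, and let $c>0$. Let $\phi:[-1,0]\to\mathbb{R}$ be a continuous function satisfying $$ce^{rs}\le\phi(s),\quad s\in[-1,0],\qquad \phi(0)=c,\qquad \phi(-1)>ce^{-r}.$$ Let $x$ be the solution of $$\frac{d}{dt}x(t)=r\,x(t)\left(1+\alpha x(t)-x(t-1)\right)$$ with initial function $\phi$. Then $x(t)<ce^{rt}$ for all $t>0$, and consequently the solution exists on $[-1,\infty)$.
   Context: The solution with initial function $\phi$ is the continuous function $x$ on its maximal interval of existence $[-1,T)$, $0<T\le\infty$, with $x(\theta)=\phi(\theta)$ for $\theta\in[-1,0]$ and satisfying the differential equation for $0\le t<T$ (right-hand derivative at $t=0$). The solution exists on $[-1,\infty)$ if $T=\infty$. *)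

(* Defs.v *)
(* World: Stdlib reals with Coquelicot. *)
From Stdlib Require Import Reals.
From Coquelicot Require Import Coquelicot.
Open Scope R_scope.

Definition is_right_derive (f : R -> R) (t l : R) : Prop :=
  filterlim (fun s => (f s - f t) / (s - t)) (at_right t) (locally l).

Definition dde_rhs (r alpha : R) (x : R -> R) (t : R) : R :=
  r * x t * (1 + alpha * x t - x (t - 1)).

(* Functions are total, but only the values of [x] on [-1, T) and those of
   [phi] on [-1, 0] matter. [T] may be [p_infty]. *)
Definition is_solution (r alpha : R) (phi : R -> R) (T : Rbar) (x : R -> R)
  : Prop :=
  Rbar_lt 0 T /\
  continuous_on (fun t => -1 <= t /\ Rbar_lt t T) x /\
  (forall theta, -1 <= theta <= 0 -> x theta = phi theta) /\
  is_right_derive x 0 (dde_rhs r alpha x 0) /\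
  (forall t, 0 < t -> Rbar_lt t T -> is_derive x t (dde_rhs r alpha x t)).

Definition is_maximal_solution (r alpha : R) (phi : R -> R) (T : Rbar)
    (x : R -> R) : Prop :=
  is_solution r alpha phi T x /\
  ~ (exists (T' : Rbar) (y : R -> R),
       Rbar_lt T T' /\
       is_solution r alpha phi T' y /\
       (forall t, -1 <= t -> Rbar_lt t T -> y t = x t)).

(* Main.v *)
(* For [y t = x t * exp (- r t)] the equation reads
   [y' t = r exp (r (t - 1)) y t (y t - y (t - 1))].  As long as [y > 0] and
   [y t < y (t - 1)], [y] strictly decreases from [y 0 = c]; since [y >= c] on
   [-1, 0], the inequality [y t < y (t - 1)] cannot be the first to fail, and
   [y] cannot reach [0] since [y' / y] is bounded below on compact intervals.
   If [T] were finite, [1 / x] would solve on [(0, T)] a linear equation whose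
   coefficient involves only the known values [x (t - 1)].  The solution of the
   linear equation exists past [T] and stays positive there because [1 / x] is
   bounded away from [0], so its inverse extends [x]. *)
Require Import Defs.
From Stdlib Require Import Reals Lra.
From Coquelicot Require Import Coquelicot.
Open Scope R_scope.

Lemma mean_value (f df : R -> R) (a b : R) :
  a < b ->
  (forall t, a < t < b -> is_derive f t (df t)) ->
  (forall t, a <= t <= b -> continuous f t) ->
  exists t, a < t < b /\ f b - f a = df t * (b - a).
Proof.
  intros hab hd hc.
  assert (pr : forall t, a < t < b -> derivable_pt f t).
  { intros t ht. exists (df t). apply is_derive_Reals, hd, ht. }
  destruct (MVT f id a b pr (fun t _ => derivable_pt_id t) hab) as [t [ht E]].
  - intros t ht. apply continuity_pt_filterlim, hc, ht.
  - intros t _. apply derivable_continuous_pt, derivable_pt_id.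
  - exists t. split; [exact ht|].
    assert (E1 : derive_pt f t (pr t ht) = df t).
    { apply derive_pt_eq_0, is_derive_Reals, hd, ht. }
    assert (E2 : derive_pt id t (derivable_pt_id t) = 1).
    { apply derive_pt_eq_0, derivable_pt_lim_id. }
    rewrite E1, E2 in E. unfold id in E. lra.
Qed.

Lemma continuous_pos_near (F : R -> R) (t : R) :
  continuous F t -> 0 < F t ->
  exists d, 0 < d /\ forall s, Rabs (s - t) < d -> 0 < F s.
Proof.
  intros hF ht.
  destruct (hF (fun z => 0 < z)) as [d hd].
  - apply (open_gt 0 (F t) ht).
  - exists d. split; [apply cond_pos | exact hd].
Qed.

Lemma positivity_propagates (F : R -> R) (b : R) :
  (forall t, continuous F t) ->
  0 < F 0 ->
  (forall t, 0 < t <= b -> (forall s, 0 <= s < t -> 0 < F s) -> 0 < F t) ->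
  forall t, 0 <= t <= b -> 0 < F t.
Proof.
  intros hF h0 hstep t1 ht1.
  set (E := fun t => 0 <= t <= b /\ forall s, 0 <= s <= t -> 0 < F s).
  assert (E0 : E 0).
  { split; [lra|]. intros s hs. replace s with 0 by lra. exact h0. }
  destruct (completeness E) as [m [ub lub]].
  { exists b. intros t [ht _]. lra. }
  { exists 0. exact E0. }
  assert (m0 : 0 <= m) by (apply ub, E0).
  assert (mb : m <= b) by (apply lub; intros t [ht _]; lra).
  assert (below : forall s, 0 <= s < m -> 0 < F s).
  { intros s hs. destruct (Rlt_or_le 0 (F s)) as [h|h]; [exact h|exfalso].
    assert (m <= s); [|lra].
    apply lub. intros t [ht hEt].
    destruct (Rle_or_lt t s) as [h'|h']; [exact h'|].
    specialize (hEt s). lra. }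
  assert (Fm : 0 < F m).
  { destruct (Req_dec m 0) as [->|hm]; [exact h0|].
    apply hstep; [lra|exact below]. }
  destruct (continuous_pos_near F m (hF m) Fm) as [d [d0 hd]].
  assert (upto : forall s, 0 <= s < m + d -> 0 < F s).
  { intros s hs. destruct (Rlt_or_le s m) as [h|h]; [apply below; lra|].
    apply hd. rewrite Rabs_pos_eq; lra. }
  apply upto. split; [lra|].
  destruct (Rlt_or_le t1 (m + d)) as [h|h]; [exact h|exfalso].
  assert (m + d / 2 <= m); [|lra].
  apply ub. split; [lra|]. intros s hs. apply upto. lra.
Qed.

Definition clamp (a b s : R) : R := Rmax a (Rmin s b).

Lemma clamp_id (a b s : R) : a <= s <= b -> clamp a b s = s.
Proof.
  intros h. unfold clamp. rewrite Rmin_left by lra. apply Rmax_right; lra.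
Qed.

Lemma clamp_bounds (a b s : R) : a <= b -> a <= clamp a b s <= b.
Proof.
  intros h. unfold clamp, Rmax, Rmin.
  destruct (Rle_dec s b); destruct Rle_dec; lra.
Qed.

Lemma clamp_lipschitz (a b s t : R) :
  Rabs (clamp a b s - clamp a b t) <= Rabs (s - t).
Proof.
  unfold clamp, Rmax, Rmin, Rabs.
  repeat (destruct Rle_dec || destruct Rcase_abs); lra.
Qed.

Lemma continuous_clamp (D : R -> Prop) (f : R -> R) (a b : R) :
  a <= b -> continuous_on D f -> (forall s, a <= s <= b -> D s) ->
  forall t, continuous (fun s => f (clamp a b s)) t.
Proof.
  intros hab hf hD t P HP.
  destruct (hf (clamp a b t) (hD _ (clamp_bounds a b t hab)) P HP) as [d hd].
  exists d. intros s hs. apply hd; [|apply hD, clamp_bounds, hab].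
  change (Rabs (clamp a b s - clamp a b t) < d).
  eapply Rle_lt_trans; [apply clamp_lipschitz|exact hs].
Qed.

Lemma locally_between (a b t : R) : a < t < b -> locally t (fun s => a < s < b).
Proof.
  intros h. apply filter_and; [apply (open_gt a t)|apply (open_lt b t)]; lra.
Qed.

Lemma is_derive_clamp (f : R -> R) (a b t l : R) :
  a < t < b -> is_derive f t l -> is_derive (fun s => f (clamp a b s)) t l.
Proof.
  intros h. apply is_derive_ext_loc.
  generalize (locally_between a b t h). apply filter_imp.
  intros s hs. rewrite clamp_id; [reflexivity|lra].
Qed.

Section Comparison.

Variables (r c : R) (x : R -> R) (b : R).
Hypothesis hr : 0 < r.
Hypothesis hc : 0 < c.
Hypothesis cont : forall t, continuous x t.
Hypothesis deriv :
  forall t, 0 < t < b -> is_derive x t (dde_rhs r (exp (- r)) x t).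
Hypothesis init_ge : forall s, -1 <= s <= 0 -> c * exp (r * s) <= x s.
Hypothesis init_0 : x 0 = c.
Hypothesis init_m1 : c * exp (- r) < x (-1).

Let gap t := x (t - 1) - exp (- r) * x t.

Let continuous_delay t : continuous (fun s => x (s - 1)) t.
Proof.
  apply (continuous_comp (fun s => s - 1) x); [|apply cont].
  apply (continuous_minus (fun s : R => s) (fun _ => 1));
    [apply continuous_id|apply continuous_const].
Qed.

Let continuous_gap t : continuous gap t.
Proof.
  apply (continuous_minus (fun s => x (s - 1)) (fun s => exp (- r) * x s)).
  - apply continuous_delay.
  - apply (continuous_mult (fun _ => exp (- r)) x);
      [apply continuous_const|apply cont].
Qed.

Let weighted_derive k t : 0 < t < b ->
  is_derive (fun s => x s * exp (k * s)) t
    (x t * exp (k * t) * (r + k - r * gap t)).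
Proof.
  intros ht. unfold gap. generalize (deriv t ht). unfold dde_rhs. intros hd.
  auto_derive.
  - eexists. exact hd.
  - rewrite (is_derive_unique (fun s : R => x s) _ _ hd). ring.
Qed.

Let continuous_weighted k t : continuous (fun s => x s * exp (k * s)) t.
Proof.
  apply (continuous_mult x (fun s => exp (k * s))); [apply cont|].
  apply (continuous_comp (fun s => k * s) exp).
  - apply (continuous_mult (fun _ => k) (fun s : R => s));
      [apply continuous_const|apply continuous_id].
  - apply continuous_exp.
Qed.

Let weighted_decreasing a t :
  0 <= a < t -> t <= b -> (forall s, 0 <= s < t -> 0 < x s /\ 0 < gap s) ->
  x t * exp (- r * t) < x a * exp (- r * a).
Proof.
  intros ha ht hpos.
  destruct (mean_value (fun s => x s * exp (- r * s)) _ a t (proj2 ha)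
    (fun s hs => weighted_derive (- r) s ltac:(lra))
    (fun s _ => continuous_weighted (- r) s)) as [s [hs E]].
  destruct (hpos s ltac:(lra)) as [h1 h2].
  assert (0 < x s * exp (- r * s) * (r * gap s) * (t - a)).
  { repeat apply Rmult_lt_0_compat; try lra; apply exp_pos. }
  lra.
Qed.

Let positive_at_end t :
  0 < t <= b -> (forall s, 0 <= s < t -> 0 < x s /\ 0 < gap s) -> 0 < x t.
Proof.
  intros ht hpos.
  destruct (continuity_ab_maj gap 0 t) as [p [hp _]]; [lra| |].
  { intros s _. apply continuity_pt_filterlim, continuous_gap. }
  set (k := r * gap p - r).
  destruct (mean_value (fun s => x s * exp (k * s)) _ 0 t (proj1 ht)
    (fun s hs => weighted_derive k s ltac:(lra))
    (fun s _ => continuous_weighted k s)) as [s [hs E]].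
  destruct (hpos s ltac:(lra)) as [h1 _].
  assert (0 <= x s * exp (k * s) * (r + k - r * gap s) * (t - 0)).
  { assert (r * gap s <= r * gap p).
    { apply Rmult_le_compat_l; [lra|]. apply hp. lra. }
    repeat apply Rmult_le_pos; try lra.
    - left; apply exp_pos.
    - unfold k; lra. }
  rewrite Rmult_0_r, exp_0 in E.
  apply (Rmult_lt_reg_r (exp (k * t))); [apply exp_pos|]. lra.
Qed.

(* In terms of [y t = x t * exp (- r t)], [0 < gap t] says [y t < y (t - 1)]. *)
Let gap_exp t :
  gap t * exp (- r * (t - 1)) =
  x (t - 1) * exp (- r * (t - 1)) - x t * exp (- r * t).
Proof.
  unfold gap. replace (- r * t) with (- r + - r * (t - 1)) by ring.
  rewrite exp_plus. ring.
Qed.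

Let positive_and_gap t : 0 <= t <= b -> 0 < x t /\ 0 < gap t.
Proof.
  intros ht.
  enough (0 < Rmin (x t) (gap t)).
  { generalize (Rmin_l (x t) (gap t)) (Rmin_r (x t) (gap t)). lra. }
  revert t ht. apply positivity_propagates.
  - intros t. apply (continuous_ext (fun s => (x s + gap s - Rabs (x s - gap s)) / 2)).
    { intros s. unfold Rmin, Rabs.
      destruct Rle_dec; destruct Rcase_abs; lra. }
    apply (continuous_mult (fun s => x s + gap s - Rabs (x s - gap s))
             (fun _ => / 2)); [|apply continuous_const].
    apply (continuous_minus (fun s => x s + gap s) (fun s => Rabs (x s - gap s))).
    + apply (continuous_plus x gap); [apply cont|apply continuous_gap].
    + apply (continuous_comp (fun s => x s - gap s) Rabs);
        [|apply continuous_Rabs].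
      apply (continuous_minus x gap); [apply cont|apply continuous_gap].
  - apply Rmin_glb_lt; [lra|]. unfold gap.
    replace (0 - 1) with (-1) by ring. rewrite init_0. lra.
  - intros t ht hF.
    assert (hpos : forall s, 0 <= s < t -> 0 < x s /\ 0 < gap s).
    { intros s hs. specialize (hF s hs).
      generalize (Rmin_l (x s) (gap s)) (Rmin_r (x s) (gap s)). lra. }
    apply Rmin_glb_lt; [apply positive_at_end; assumption|].
    apply (Rmult_lt_reg_r (exp (- r * (t - 1)))); [apply exp_pos|].
    rewrite Rmult_0_l, gap_exp.
    destruct (Rle_or_lt t 1) as [h|h].
    + assert (H := weighted_decreasing 0 t ltac:(lra) ltac:(lra) hpos).
      rewrite Rmult_0_r, exp_0, init_0 in H.
      assert (H' := init_ge (t - 1) ltac:(lra)).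
      apply (Rmult_le_compat_r (exp (- r * (t - 1)))) in H';
        [|left; apply exp_pos].
      rewrite Rmult_assoc, <- exp_plus in H'.
      replace (r * (t - 1) + - r * (t - 1)) with 0 in H' by ring.
      rewrite exp_0 in H'. lra.
    + assert (H := weighted_decreasing (t - 1) t ltac:(lra) ltac:(lra) hpos).
      lra.
Qed.

Lemma comparison t : 0 < t <= b -> 0 < x t < c * exp (r * t).
Proof.
  intros ht. split; [apply positive_and_gap; lra|].
  assert (H := weighted_decreasing 0 t ltac:(lra) ltac:(lra)
    (fun s hs => positive_and_gap s ltac:(lra))).
  rewrite Rmult_0_r, exp_0, init_0 in H.
  apply (Rmult_lt_reg_r (exp (- r * t))); [apply exp_pos|].
  rewrite Rmult_assoc, <- exp_plus.
  replace (r * t + - r * t) with 0 by ring.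
  rewrite exp_0. lra.
Qed.

End Comparison.

Lemma is_derive_RInt_continuous (f : R -> R) (a t : R) :
  (forall s, continuous f s) -> is_derive (RInt f a) t (f t).
Proof.
  intros hf. apply (is_derive_RInt f (RInt f a) a t).
  - apply filter_forall. intros s.
    apply (RInt_correct f), (ex_RInt_continuous f). intros; apply hf.
  - apply hf.
Qed.

Lemma is_derive_continuous (f : R -> R) (t l : R) :
  is_derive f t l -> continuous f t.
Proof. intros h. apply (ex_derive_continuous f). exists l. exact h. Qed.

(* The substitution [u = 1 / x] turns [x' = r x (1 + alpha x - p)] into this
   linear equation. *)
Lemma linear_solution (r alpha t0 u0 : R) (p : R -> R) :
  (forall t, continuous p t) ->
  exists u,
    (forall t, is_derive u t (r * (p t - 1) * u t - r * alpha)) /\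
    (forall w b, w t0 = u0 ->
      (forall t, t0 <= t <= b ->
        is_derive w t (r * (p t - 1) * w t - r * alpha)) ->
      forall t, t0 <= t <= b -> w t = u t).
Proof.
  intros hp.
  assert (hq : forall t, continuous (fun s => r * (1 - p s)) t).
  { intros t. apply (continuous_mult (fun _ => r) (fun s => 1 - p s));
      [apply continuous_const|].
    apply (continuous_minus (fun _ => 1) p); [apply continuous_const|apply hp]. }
  set (A := RInt (fun s => r * (1 - p s)) t0).
  assert (dA : forall t, is_derive A t (r * (1 - p t))).
  { intros t. apply (is_derive_RInt_continuous (fun s => r * (1 - p s))), hq. }
  assert (hE : forall t, continuous (fun s => exp (A s)) t).
  { intros t. apply (continuous_comp A exp);
      [eapply is_derive_continuous, dA|apply continuous_exp]. }
  set (B := RInt (fun s => exp (A s)) t0).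
  assert (dB : forall t, is_derive B t (exp (A t))).
  { intros t. apply (is_derive_RInt_continuous (fun s => exp (A s))), hE. }
  assert (expA : forall t, exp (- A t) * exp (A t) = 1).
  { intros t. rewrite <- exp_plus.
    replace (- A t + A t) with 0 by ring. apply exp_0. }
  exists (fun t => exp (- A t) * (u0 - r * alpha * B t)). split.
  - intros t. auto_derive.
    + repeat split; eexists; [apply dA|apply dB].
    + rewrite (is_derive_unique (fun s : R => A s) _ _ (dA t)), (is_derive_unique (fun s : R => B s) _ _ (dB t)).
      transitivity (r * (p t - 1) * (exp (- A t) * (u0 - r * alpha * B t))
        - r * alpha * (exp (- A t) * exp (A t))); [ring|].
      rewrite expA; ring.
  - intros w b w0 dw t ht.
    set (V := fun s => w s * exp (A s) + r * alpha * B s).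
    assert (dV : forall s, t0 <= s <= b -> is_derive V s 0).
    { intros s hs. unfold V. auto_derive.
      - repeat split; eexists; [apply dw, hs|apply dA|apply dB].
      - rewrite (is_derive_unique (fun s : R => A s) _ _ (dA s)), (is_derive_unique (fun s : R => B s) _ _ (dB s)),
          (is_derive_unique (fun s : R => w s) _ _ (dw s hs)). ring. }
    assert (Vt : V t = u0).
    { replace u0 with (V t0).
      2: { unfold V, A, B. rewrite !RInt_point, w0. unfold zero; simpl.
           rewrite exp_0. ring. }
      destruct (Req_dec t t0) as [->|ne]; [reflexivity|].
      destruct (mean_value V (fun _ => 0) t0 t) as [s [_ E]]; [lra| | |lra].
      - intros s hs. apply dV. lra.
      - intros s hs. eapply is_derive_continuous, dV. lra. }
    rewrite <- Vt. unfold V.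
    transitivity (w t * (exp (- A t) * exp (A t))); [|ring].
    rewrite expA. ring.
Qed.

Lemma solution_extends (r alpha T m : R) (phi x : R -> R) :
  0 < m ->
  is_solution r alpha phi T x ->
  (forall t, 0 < t < T -> 0 < x t < / m) ->
  exists (T' : R) (y : R -> R),
    T < T' /\ is_solution r alpha phi T' y /\
    (forall t, -1 <= t < T -> y t = x t).
Proof.
  intros hm (hT & hcont & hinit & hright & hderiv) hbound.
  simpl in hT, hcont, hderiv.
  set (p := fun s => x (clamp (-1) (T - 1 / 2) (s - 1))).
  assert (hp : forall t, continuous p t).
  { intros t.
    apply (continuous_comp (fun s => s - 1)
      (fun s => x (clamp (-1) (T - 1 / 2) s))).
    - apply (continuous_minus (fun s : R => s) (fun _ => 1));
        [apply continuous_id|apply continuous_const].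
    - eapply continuous_clamp; [lra|exact hcont|]. simpl. intros; lra. }
  assert (p_delay : forall t, 0 <= t <= T + 1 / 2 -> p t = x (t - 1)).
  { intros t ht. unfold p. rewrite clamp_id; [reflexivity|lra]. }
  destruct (linear_solution r alpha (T / 2) (/ x (T / 2)) p hp)
    as [u [du uniq]].
  assert (ux : forall t, T / 2 <= t < T -> u t = / x t).
  { intros t ht. symmetry. apply (uniq (fun s => / x s) t); [reflexivity| |lra].
    intros s hs. assert (hd := hderiv s ltac:(lra) ltac:(lra)).
    assert (x s > 0) by (apply hbound; lra).
    unfold dde_rhs in hd. auto_derive.
    - split; [eexists; exact hd|lra].
    - rewrite (is_derive_unique (fun s : R => x s) _ _ hd), p_delay by lra. field. lra. }
  assert (uT : 0 < u T).
  { destruct (Rlt_or_le 0 (u T)) as [h|h]; [exact h|exfalso].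
    destruct (continuous_pos_near (fun s => m - u s) T) as [d [d0 hd]]; [|lra|].
    { apply (continuous_minus (fun _ => m) u); [apply continuous_const|].
      eapply is_derive_continuous, du. }
    set (s := Rmax (T / 2) (T - d / 2)).
    assert (hs : T / 2 <= s < T /\ T - d / 2 <= s).
    { unfold s, Rmax. destruct Rle_dec; lra. }
    specialize (hd s). rewrite Rabs_left in hd by lra.
    destruct (hbound s ltac:(lra)) as [h1 h2].
    rewrite (ux s) in hd by lra.
    apply Rinv_lt_contravar in h2.
    - rewrite Rinv_inv in h2. lra.
    - apply Rmult_lt_0_compat; [exact h1|]. apply Rinv_0_lt_compat, hm. }
  destruct (continuous_pos_near u T (is_derive_continuous _ _ _ (du T)) uT)
    as [d [d0 hd]].
  set (T' := T + Rmin d (1 / 2)).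
  assert (hT' : T < T' /\ T' <= T + d /\ T' <= T + 1 / 2).
  { unfold T', Rmin. destruct Rle_dec; lra. }
  assert (upos : forall t, T / 2 <= t < T' -> 0 < u t).
  { intros t ht. destruct (Rlt_or_le t T) as [h|h].
    - rewrite ux by lra. apply Rinv_0_lt_compat, hbound. lra.
    - apply hd. rewrite Rabs_pos_eq; lra. }
  set (y := fun t => if Rlt_dec t T then x t else / u t).
  assert (yx : forall t, t < T -> y t = x t).
  { intros t ht. unfold y. destruct Rlt_dec; [reflexivity|lra]. }
  assert (yu : forall t, T / 2 <= t -> y t = / u t).
  { intros t ht. unfold y. destruct Rlt_dec; [|reflexivity].
    rewrite ux by lra. symmetry. apply Rinv_inv. }
  assert (dy : forall t, 0 < t -> t < T' -> is_derive y t (dde_rhs r alpha y t)).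
  { intros t h0 h1. unfold dde_rhs. rewrite (yx (t - 1)) by lra.
    destruct (Rlt_or_le t T) as [h|h].
    - rewrite (yx t h). apply (is_derive_ext_loc x); [|apply hderiv; lra].
      generalize (open_lt T t h). apply filter_imp.
      intros s hs. symmetry. apply yx, hs.
    - apply (is_derive_ext_loc (fun s => / u s)).
      + generalize (open_gt (T / 2) t ltac:(lra)). apply filter_imp.
        intros s hs. symmetry. apply yu. lra.
      + assert (hu := upos t ltac:(lra)). auto_derive.
        * split; [eexists; apply du|lra].
        * rewrite (is_derive_unique (fun s : R => u s) _ _ (du t)), yu, p_delay by lra.
          field. lra. }
  exists T', y. split; [lra|]. split; [|intros t ht; apply yx; lra].
  split; [simpl; lra|]. split; [|split; [|split]].
  - simpl. intros t ht. destruct (Rlt_or_le 0 t) as [h|h].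
    + eapply filterlim_filter_le_1; [apply filter_le_within|].
      eapply is_derive_continuous, dy; lra.
    + rewrite yx by lra.
      intros P HP. assert (hx := hcont t ltac:(lra) P HP).
      unfold filtermap, within in *.
      generalize (filter_and _ _ hx (open_lt T t ltac:(lra))). apply filter_imp.
      intros s [h1 h2] h3. rewrite yx by exact h2. apply h1. lra.
  - intros s hs. rewrite yx by lra. apply hinit, hs.
  - unfold is_right_derive, dde_rhs in *. rewrite !yx by lra.
    eapply filterlim_ext_loc; [|exact hright].
    apply filter_le_within. generalize (open_lt T 0 hT). apply filter_imp.
    intros s hs. rewrite yx by exact hs. reflexivity.
  - simpl. exact dy.
Qed.

Theorem theorem6 (r alpha c : R) (phi : R -> R) (T : Rbar) (x : R -> R)
  (hr : 0 < r) (halpha : alpha = exp (- r)) (hc : 0 < c)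
  (hphi_cont : continuous_on (fun s => -1 <= s <= 0) phi)
  (hphi_ge : forall s, -1 <= s <= 0 -> c * exp (r * s) <= phi s)
  (hphi_0 : phi 0 = c)
  (hphi_m1 : phi (-1) > c * exp (- r))
  (hx : is_maximal_solution r alpha phi T x) :
  (forall t, 0 < t -> Rbar_lt t T -> x t < c * exp (r * t)) /\
  T = p_infty.
Proof.
  subst alpha. destruct hx as [hsol hmax].
  destruct (hsol) as (hT & hcont & hinit & _ & hderiv).
  assert (hbound : forall t, 0 < t -> Rbar_lt t T -> 0 < x t < c * exp (r * t)).
  { intros t ht htT.
    assert (below : forall s, s <= t -> Rbar_lt s T).
    { intros s hs. eapply Rbar_le_lt_trans; [|exact htT]. exact hs. }
    replace (x t) with (x (clamp (-1) t t)) by (rewrite clamp_id; [reflexivity|lra]).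
    apply (comparison r c (fun s => x (clamp (-1) t s)) t hr hc); [| | | | |lra].
    - eapply continuous_clamp; [lra|exact hcont|].
      intros s hs. split; [lra|apply below; lra].
    - intros s hs. unfold dde_rhs. rewrite !clamp_id by lra.
      apply is_derive_clamp; [lra|]. apply hderiv; [lra|apply below; lra].
    - intros s hs. rewrite clamp_id, hinit by lra. apply hphi_ge, hs.
    - rewrite clamp_id, hinit by lra. exact hphi_0.
    - rewrite clamp_id, hinit by lra. exact hphi_m1. }
  split; [intros; apply hbound; assumption|].
  destruct T as [T| |]; [exfalso|reflexivity|contradiction].
  destruct (solution_extends r (exp (- r)) T (/ (c * exp (r * T))) phi x)
    as (T' & y & h1 & h2 & h3).
  - apply Rinv_0_lt_compat, Rmult_lt_0_compat; [exact hc|apply exp_pos].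
  - exact hsol.
  - intros t ht. rewrite Rinv_inv.
    destruct (hbound t ltac:(lra) (proj2 ht)) as [hp hlt].
    split; [exact hp|]. eapply Rlt_trans; [exact hlt|].
    apply Rmult_lt_compat_l; [exact hc|]. apply exp_increasing.
    apply Rmult_lt_compat_l; lra.
  - apply hmax. exists T', y. split; [exact h1|]. split; [exact h2|].
    intros t ha hb. apply h3. split; assumption.
Qed.
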